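(* Let $I\subseteq\mathbb{R}$ be an interval, let $f:I\to\mathbb{R}$ be a continuous twice differentiable function such that $\alpha\le f''\le\beta$ on $I$, where $\alpha,\beta\in\mathbb{R}$, and let $\Phi:\mathcal{B}(\mathcal{H})\to\mathcal{B}(\mathcal{K})$ be a unital positive linear map. Then for any self-adjoint operator $A$ on $\mathcal{H}$ with spectrum $Sp(A)\subseteq[m,M]\subset I$, $$f(\Phi(A))\le\Phi(f(A))+\frac{\beta-\alpha}{2}\left\{(M+m)\Phi(A)-Mm\right\}+\frac12\left(\alpha\Phi(A)^2-\beta\Phi(A^2)\right)$$ and $$\Phi(f(A))\le f(\Phi(A))+\frac{\beta-\alpha}{2}\left\{(M+m)\Phi(A)-Mm\right\}+\frac12\left(\alpha\Phi(A^2)-\beta\Phi(A)^2\right).$$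
   Context: $\mathcal{H},\mathcal{K}$ are Hilbert spaces and $\mathcal{B}(\mathcal{H})$, $\mathcal{B}(\mathcal{K})$ are the algebras of bounded linear operators on them. A linear map $\Phi$ is positive if it maps positive (semidefinite) operators to positive operators, and unital if $\Phi$ maps the identity to the identity. $f(A)$ is the continuous functional calculus, $\le$ is the Loewner order on self-adjoint operators, and scalars in operator expressions denote multiples of the identity. $\Phi(A)^2$ means $(\Phi(A))^2$. *)

(* Defs.v *)
From HB Require Import structures.
From mathcomp Require Import all_boot all_order all_algebra.
From mathcomp Require Import sesquilinear.
From mathcomp Require Import all_classical all_reals all_analysis.
From mathcomp Require Import complex.

Set Implicit Arguments.
Unset Strict Implicit.
Unset Printing Implicit Defensive.

Import Order.TTheory GRing.Theory Num.Theory.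
Import numFieldNormedType.Exports.
Local Open Scope classical_set_scope.
Local Open Scope ring_scope.
Local Open Scope complex_scope.

(* Complex Hilbert spaces. Norms of a [normedModType R[i]] take values in
   R[i] (they are nonnegative, hence real); the inner product is linear in its
   first argument and conjugate-linear in the second one. *)
HB.mixin Record CompleteNormedModule_isHilbert (R : realType) H
    of CompleteNormedModule R[i] H := {
  dotp : {dot H for (@Num.conj R[i])};
  dotp_norm : forall x : H, dotp x x = `|x| ^+ 2
}.

#[short(type="hilbertType")]
HB.structure Definition Hilbert (R : realType) :=
  {H of CompleteNormedModule_isHilbert R H & CompleteNormedModule R[i] H}.

Definition is_bounded_op (R : realType) (H : hilbertType R) (f : H -> H) :=
  linear f /\ exists M : R, forall x, `|f x| <= M%:C * `|x|.

Definition bounded_op (R : realType) (H : hilbertType R) : {pred (H -> H)} :=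
  [pred f | `[< is_bounded_op f >]].

(* The algebra B(H): the product is composition. *)
Definition bop (R : realType) (H : hilbertType R) := {f : H -> H | f \in @bounded_op R H}.

Section BoundedOperators.
Context {R : realType} {H : hilbertType R}.
Implicit Types (A B : bop H).

Lemma bounded_op_submod_closed : submod_closed (@bounded_op R H).
Proof.
split.
  apply/asboolP; split; first by move=> a x y; rewrite -[RHS]/(a *: 0 + 0) scaler0 addr0.
  by exists 0 => x; rewrite -[leLHS]/(`|0 : H|) normr0 mul0r.
move=> a f g /asboolP[lf [M hM]] /asboolP[lg [N hN]].
have E z : (a *: f + g) z = a *: f z + g z by [].
apply/asboolP; split.
  move=> b x y; rewrite !E lf lg !scalerDr !scalerA addrACA.
  by rewrite [b * a]mulrC.
exists (complex.Re `|a| * M + N) => x; rewrite E.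
apply: (le_trans (ler_normD _ _)).
rewrite rmorphD rmorphM /= mulrDl lerD// normrZ -mulrA.
have -> : (complex.Re `|a|)%:C = `|a| by apply: RRe_real; exact: normr_real.
by rewrite ler_wpM2l.
Qed.

HB.instance Definition _ :=
  GRing.isSubmodClosed.Build R[i] (H -> H) (@bounded_op R H)
    bounded_op_submod_closed.

HB.instance Definition _ := SubChoice.on (bop H).
HB.instance Definition _ := [SubChoice_isSubLmodule of bop H by <:].

Definition bop_apply A : H -> H := val A.
Coercion bop_apply : bop >-> Funclass.

Lemma bop_one_subproof : (@id H) \in @bounded_op R H.
Proof.
apply/asboolP; split; first by [].
by exists 1 => x; rewrite mul1r.
Qed.

Lemma bop_mul_subproof A B : A \o B \in @bounded_op R H.
Proof.
case: A B => [f hf] [g hg]; rewrite /bop_apply /=.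
have /asboolP[lf [M hM]] := hf; have /asboolP[lg [N hN]] := hg.
apply/asboolP; split; first by move=> a x y; rewrite /= lg lf.
exists (Num.max M 0 * Num.max N 0) => x /=.
apply: (le_trans (hM _)).
have M0 (P : R) (z : H) : P%:C * `|z| <= (Num.max P 0)%:C * `|z|.
  by rewrite ler_wpM2r// lecR le_max lexx.
apply: (le_trans (M0 _ _)); rewrite rmorphM /= -mulrA ler_wpM2l//.
  by rewrite ler0c le_max lexx orbT.
exact: (le_trans (hN _)).
Qed.

Definition bop_one : bop H := Sub id bop_one_subproof.
Definition bop_mul A B : bop H := Sub (A \o B) (bop_mul_subproof A B).

Lemma bop_linear A : linear A.
Proof. by case: A => f hf; have /asboolP[] := hf. Qed.

Lemma bop_mulA : associative bop_mul.
Proof. by move=> A B C; apply/val_inj. Qed.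
Lemma bop_mul1r : left_id bop_one bop_mul.
Proof. by move=> A; apply/val_inj. Qed.
Lemma bop_mulr1 : right_id bop_one bop_mul.
Proof. by move=> A; apply/val_inj. Qed.
Lemma bop_mulDl : left_distributive bop_mul +%R.
Proof. by move=> A B C; apply/val_inj/funext. Qed.
Lemma bop_mulDr : right_distributive bop_mul +%R.
Proof.
move=> A B C; apply/val_inj/funext => x.
by have := bop_linear A 1 (B x) (C x); rewrite !scale1r.
Qed.

HB.instance Definition _ := GRing.Zmodule_isPzRing.Build (bop H)
  bop_mulA bop_mul1r bop_mulr1 bop_mulDl bop_mulDr.

End BoundedOperators.

Section Operators.
Context {R : realType} {H : hilbertType R}.
Implicit Types (A B : bop H) (f : R -> R) (p : {poly R}).

Definition selfadjoint A := forall x y : H, dotp (A x) y = dotp x (A y).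

(* In the order of R[i], [0 <= z] means that z is real and nonnegative. *)
Definition positive_op A := forall x : H, 0 <= dotp (A x) x.

Definition loewner_le A B := positive_op (B - A).

Definition scalar_op (z : R[i]) : bop H := z *: (1 : bop H).

Definition spectrum A : set R[i] :=
  [set z : R[i] | ~ exists B, (A - scalar_op z) * B = 1 /\ B * (A - scalar_op z) = 1].

Definition poly_op p A : bop H := \sum_(i < size p) (p`_i)%:C *: (A ^+ i : bop H).

(* B is the limit in operator norm of p_n(A), for real polynomials p_n
   converging to f uniformly on the spectrum of the self-adjoint operator A
   (which is real). *)
Definition is_cfc f A B := exists p : nat -> {poly R},
  (forall e : R, 0 < e -> \forall n \near \oo,
     forall t : R, spectrum A t%:C -> `|(p n).[t] - f t| <= e) /\
  (forall e : R, 0 < e -> \forall n \near \oo,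
     forall x : H, `|poly_op (p n) A x - B x| <= e%:C * `|x|).

(* The continuous functional calculus f(A). For A self-adjoint and f
   continuous on the spectrum of A there is exactly one B with [is_cfc f A B];
   outside of this case the value is irrelevant. *)
Definition cfc f A : bop H := xget 0 [set B | is_cfc f A B].

End Operators.

Notation "A <=L B" := (loewner_le A B) (at level 70, no associativity) : ring_scope.

(* l is the derivative at x of f as a function on I (one-sided at an endpoint
   of I that belongs to I). *)
Definition has_derivative_within (R : realType) (I : set R) (f : R -> R)
    (x l : R) :=
  (fun y => (f y - f x) / (y - x)) @ within I x^' --> l.

Section PositiveMaps.
Context {R : realType} {H K : hilbertType R}.
Definition positive_map (Phi : bop H -> bop K) :=
  forall A, positive_op A -> positive_op (Phi A).
Definition unital_map (Phi : bop H -> bop K) := Phi 1 = 1.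
End PositiveMaps.

(* Main.v *)
(* Let c + d t be the chord of f on [m, M]. Since f - alpha t^2 / 2 is convex
   and f - beta t^2 / 2 is concave, with W t = (M + m) t - M m - t^2,
     c + d t - beta / 2 W t <= f t <= c + d t - alpha / 2 W t on [m, M].
   The functional calculus is monotone and Phi A again has its spectrum in
   [m, M], so these bounds hold at A, where Phi preserves them, and at Phi A.
   The affine part of W makes the same contribution to both, and comparing the
   upper bound at one operator with the lower bound at the other gives the two
   inequalities.

   Monotonicity of the calculus reduces to polynomials p >= 0 on the spectrum:
   p(A) + s is invertible for s > 0 by factoring p + s over the complex
   numbers, and a self-adjoint operator without negative spectrum is positive
   because the infimum of its numerical range belongs to its spectrum. *)

Require Import Defs.
From HB Require Import structures.
From mathcomp Require Import all_boot all_order all_algebra.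
From mathcomp Require Import all_classical all_reals all_analysis.
From mathcomp Require Import sesquilinear complex ring lra.

Import Order.TTheory GRing.Theory Num.Theory.
Import numFieldNormedType.Exports.
Local Open Scope classical_set_scope.
Local Open Scope ring_scope.
Local Open Scope complex_scope.

(** * The real inner product *)

Section RealInnerProduct.
Context {R : realType} {H : hilbertType R}.
Implicit Types (x y z : H) (a : R) (T : bop H).

(** The real parts keep estimates in the ordered field [R] instead of [R[i]]. *)
Definition rdot x y : R := complex.Re (dotp x y).
Definition nrm x : R := complex.Re `|x|.

Lemma rdotC x y : rdot x y = rdot y x.
Proof. by rewrite /rdot hermC /= expr0 mul1r; case: (dotp y x). Qed.

Lemma rdotDl x y z : rdot (x + y) z = rdot x z + rdot y z.
Proof. by rewrite /rdot linearDl raddfD. Qed.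

Lemma rdotBl x y z : rdot (x - y) z = rdot x z - rdot y z.
Proof. by rewrite /rdot linearBl raddfB. Qed.

Lemma ReZ a (z : R[i]) : complex.Re (a%:C * z) = a * complex.Re z.
Proof. by case: z => u v /=; rewrite mul0r subr0. Qed.

Lemma rdotZl a x y : rdot (a%:C *: x) y = a * rdot x y.
Proof. by rewrite /rdot linearZl_LR ReZ. Qed.

Lemma rdotDr x y z : rdot z (x + y) = rdot z x + rdot z y.
Proof. by rewrite rdotC rdotDl !(rdotC z). Qed.

Lemma rdotBr x y z : rdot z (x - y) = rdot z x - rdot z y.
Proof. by rewrite rdotC rdotBl !(rdotC z). Qed.

Lemma rdotZr a x y : rdot y (a%:C *: x) = a * rdot y x.
Proof. by rewrite rdotC rdotZl rdotC. Qed.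

Lemma normE x : `|x| = (nrm x)%:C.
Proof. by rewrite /nrm RRe_real// normr_real. Qed.

Lemma nrm_ge0 x : 0 <= nrm x.
Proof. by rewrite -ler0c -normE. Qed.

Lemma rdot_nrm x : rdot x x = nrm x ^+ 2.
Proof. by rewrite /rdot dotp_norm normE -rmorphXn. Qed.

Lemma rdot_ge0 x : 0 <= rdot x x.
Proof. by rewrite rdot_nrm sqr_ge0. Qed.

Lemma nrm_eq0 x : nrm x = 0 -> x = 0.
Proof. by move=> x0; apply/normr0_eq0; rewrite normE x0. Qed.

Lemma nrm0 : nrm (0 : H) = 0.
Proof. by rewrite /nrm normr0. Qed.

Lemma nrmD x y : nrm (x + y) <= nrm x + nrm y.
Proof. by rewrite -lecR rmorphD /= -!normE ler_normD. Qed.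

Lemma nrmN x : nrm (- x) = nrm x.
Proof. by rewrite /nrm normrN. Qed.

Lemma nrmB x y : nrm (x - y) <= nrm x + nrm y.
Proof. by rewrite -(nrmN y) nrmD. Qed.

Lemma nrmZ a x : nrm (a%:C *: x) = `|a| * nrm x.
Proof.
rewrite /nrm normrZ normc_def /= expr0n addr0 sqrtr_sqr.
exact: ReZ.
Qed.

Lemma nrm_le (c : R) x y : 0 <= c -> rdot x x <= c ^+ 2 * rdot y y ->
  nrm x <= c * nrm y.
Proof.
move=> c0; by rewrite !rdot_nrm -exprMn ler_sqr// nnegrE ?mulr_ge0// nrm_ge0.
Qed.

Lemma rdot_le_nrm x y : rdot x y <= nrm x * nrm y.
Proof.
have [|x0] := leP (nrm x) 0.
  rewrite le_eqVlt ltNge nrm_ge0 orbF => /eqP x0.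
  by rewrite x0 (nrm_eq0 x x0) /rdot linear0l mul0r.
have [|y0] := leP (nrm y) 0.
  rewrite le_eqVlt ltNge nrm_ge0 orbF => /eqP y0.
  by rewrite rdotC y0 (nrm_eq0 y y0) /rdot linear0l mulr0.
(* Expanding this square gives Cauchy-Schwarz multiplied by [2 * nrm x * nrm y], a factor that is
   positive once the two degenerate cases are gone. *)
have := rdot_ge0 ((nrm y)%:C *: x - (nrm x)%:C *: y).
rewrite rdotBl !rdotBr !rdotZl !rdotZr (rdotC y x) !rdot_nrm => h.
rewrite -(@ler_pM2l _ (nrm x * nrm y)) ?mulr_gt0//; nra.
Qed.

Lemma abs_rdot_le_nrm x y : `|rdot x y| <= nrm x * nrm y.
Proof.
rewrite ler_norml rdot_le_nrm andbT lerNl -[leLHS]mulN1r -rdotZl.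
apply: (le_trans (rdot_le_nrm _ _)).
by rewrite nrmZ normrN1 mul1r.
Qed.

Lemma hilbert_complete (u : nat -> H) :
  (forall e : R, 0 < e -> exists N, forall n k, (N <= n)%N -> (N <= k)%N ->
    nrm (u n - u k) <= e) ->
  exists l, forall e : R, 0 < e -> exists N, forall n, (N <= n)%N ->
    nrm (u n - l) <= e.
Proof.
move=> cu.
have /cauchy_cvgP/cvg_ex[l ul] : cauchy (u @ \oo).
  apply: cauchy_exP => e e0.
  (* A positive element of [R[i]] is real, so its real part can serve as the tolerance. *)
  have e0R : 0 < complex.Re e by move: e0; rewrite ltcE => /andP[].
  have eE : e = (complex.Re e)%:C by rewrite RRe_real// gtr0_real.
  have [|N hN] := cu (complex.Re e / 2); first by rewrite divr_gt0.
  exists (u N), N => // n /= Nn.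
  rewrite -ball_normE /= normE eE ltcR (le_lt_trans (hN _ _ _ _))//.
  by rewrite ltr_pdivrMr// ltr_pMr// ltr1n.
exists l => e e0.
move/cvgrPdist_le: ul => /(_ e%:C); rewrite (ltcR 0) => /(_ e0)[N _ hN].
exists N => n Nn; have := hN n Nn.
by rewrite -lecR -nrmN opprB -normE.
Qed.

End RealInnerProduct.

(** * Bounded operators and their quadratic forms *)

Section BoundedOperatorTheory.
Context {R : realType} {H : hilbertType R}.
Implicit Types (x y z : H) (a : R) (T S : bop H).

Lemma bopP T S : (forall x, T x = S x) -> T = S.
Proof. by move=> TS; apply/val_inj/funext. Qed.

Lemma bop0E x : (0 : bop H) x = 0. Proof. by []. Qed.
Lemma bop1E x : (1 : bop H) x = x. Proof. by []. Qed.
Lemma bopDE T S x : (T + S : bop H) x = T x + S x. Proof. by []. Qed.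
Lemma bopNE T x : (- T : bop H) x = - T x. Proof. by []. Qed.
Lemma bopBE T S x : (T - S : bop H) x = T x - S x. Proof. by []. Qed.
Lemma bopZE (a : R[i]) T x : (a *: T : bop H) x = a *: T x. Proof. by []. Qed.
Lemma bopME T S x : (T * S : bop H) x = T (S x). Proof. by []. Qed.

Definition bopE := (bop0E, bop1E, bopBE, bopDE, bopNE, bopZE, bopME).

Lemma bop_raddfD T x y : T (x + y) = T x + T y.
Proof. by have := bop_linear T 1 x y; rewrite !scale1r. Qed.

Lemma bop_raddf0 T : T 0 = 0.
Proof. by apply: (addIr (T 0)); rewrite -bop_raddfD !add0r. Qed.

Lemma bop_linearZ T (a : R[i]) x : T (a *: x) = a *: T x.
Proof. by have := bop_linear T a x 0; rewrite bop_raddf0 !addr0. Qed.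

Lemma bop_raddfN T x : T (- x) = - T x.
Proof. by rewrite -scaleN1r bop_linearZ scaleN1r. Qed.

Lemma bop_raddfB T x y : T (x - y) = T x - T y.
Proof. by rewrite bop_raddfD bop_raddfN. Qed.

Lemma bop_scalerAl (a : R[i]) T S : (a *: T) * S = a *: (T * S).
Proof. exact: bopP. Qed.

Lemma bop_scalerAr (a : R[i]) T S : T * (a *: S) = a *: (T * S).
Proof. by apply: bopP => x; rewrite !bopE bop_linearZ. Qed.

Lemma bop_bounded T : exists2 c : R, 0 < c & forall x, nrm (T x) <= c * nrm x.
Proof.
case: T => f hf; have /asboolP[lf [M hM]] := hf.
exists (Num.max M 1); first by rewrite lt_max ltr01 orbT.
move=> x; apply: (@le_trans _ _ (M * nrm x)).
  by have := hM x; rewrite !normE -rmorphM lecR.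
by rewrite ler_wpM2r ?nrm_ge0// le_max lexx.
Qed.

(** The real form loses nothing: evaluated at ['i *: u] it returns minus the imaginary part of
    [dotp u v]. *)
Lemma selfadjointP T :
  selfadjoint T <-> forall x y, rdot (T x) y = rdot x (T y).
Proof.
split=> [sT x y|sT x y]; first by rewrite /rdot sT.
have Ei (u v : H) : complex.Im (dotp u v) = - rdot ('i *: u) v.
  by rewrite /rdot linearZl_LR /= mulrC ReiNIm opprK.
by apply/eqP; rewrite eq_complex -!/(rdot _ _) !Ei sT -bop_linearZ sT !eqxx.
Qed.

(** On a complex space a real-valued quadratic form forces self-adjointness, by polarization.
    Conversely, self-adjointness makes [dotp (T x) x] equal to its own conjugate. *)
Lemma positive_opP T :
  positive_op T <-> selfadjoint T /\ forall x, 0 <= rdot (T x) x.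
Proof.
split=> [pT|[sT pT] x].
  have im0 x : complex.Im (dotp (T x) x) = 0.
    by have := pT x; rewrite lecE => /andP[/eqP].
  split=> [|x]; last by have := pT x; rewrite lecE => /andP[].
  apply/selfadjointP => x y; rewrite (rdotC x).
  (* The imaginary part of the form at this vector is the difference of [rdot (T y) x] and
     [rdot (T x) y]. *)
  have := im0 (x + 'i *: y).
  rewrite bop_raddfD bop_linearZ !linearDl !linearDr /=.
  rewrite !linearZl_LR !linearZr_LR /= !raddfD /= !im0.
  rewrite /rdot; have := im0 y; case: (dotp (T y) y) => a b /= ->.
  by case: (dotp (T x) y) (dotp (T y) x) => ? ? [? ?] /=; lra.
rewrite lecE /= -/(rdot _ _) pT andbT; apply/eqP.
have := sT x x; rewrite [dotp x _]hermC /= expr0 mul1r.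
by case: (dotp (T x) x) => a b [] /=; lra.
Qed.

(* Evaluate the form of T at x - c^-1 T x, where c bounds T. *)
Lemma positive_bound T : positive_op T ->
  exists2 c : R, 0 < c & forall x, rdot (T x) (T x) <= c * rdot (T x) x.
Proof.
move=> /positive_opP[/selfadjointP sT pT].
have [c c0 hc] := bop_bounded T; exists c => // x.
have := pT (x - (c^-1)%:C *: T x).
rewrite bop_raddfB bop_linearZ !rdotBl !rdotBr !rdotZl !rdotZr (sT (T x) x).
have TT : rdot (T (T x)) (T x) <= c * rdot (T x) (T x).
  apply: (le_trans (rdot_le_nrm _ _)).
  by rewrite rdot_nrm expr2 mulrA ler_wpM2r ?nrm_ge0.
set P := rdot (T (T x)) _ in TT *; set Q := rdot (T x) (T x) in TT *.
set S := rdot (T x) x => h.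
have : 0 <= c * (S - c^-1 * Q - (c^-1 * Q - c^-1 * (c^-1 * P))).
  by rewrite mulr_ge0 ?(ltW c0).
have -> : c * (S - c^-1 * Q - (c^-1 * Q - c^-1 * (c^-1 * P))) =
  c * S - 2 * Q + c^-1 * P by field; exact: lt0r_neq0.
have : c^-1 * P <= Q by rewrite ler_pdivrMl.
lra.
Qed.

End BoundedOperatorTheory.

(** * Invertibility and positivity *)

Section Invertibility.
Context {R : realType} {H : hilbertType R}.
Implicit Types (x y z : H) (T S : bop H).

Lemma nrm_small x : (forall e : R, 0 < e -> nrm x <= e) -> x = 0.
Proof.
move=> h; apply: nrm_eq0; apply/eqP; rewrite eq_le nrm_ge0 andbT.
by apply/ler_addgt0Pr => e e0; rewrite add0r h.
Qed.

Lemma geometric_small (q D e : R) : 0 <= q < 1 -> 0 <= D -> 0 < e ->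
  exists N, q ^+ N * D <= e.
Proof.
move=> /andP[q0 q1] D0 e0.
have q1' : `|q| < 1 by rewrite ger0_norm.
(* The divisor is [D + 1] because [D] may be zero. *)
have /cvgrPdist_le/(_ (e / (D + 1))) := cvg_expr q1'.
rewrite divr_gt0 ?ltr_wpDl// => /(_ isT)[N _ /(_ N (leqnn N)) /=].
rewrite sub0r normrN ger0_norm ?exprn_ge0// ler_pdivlMr ?ltr_wpDl// => h.
by exists N; rewrite (le_trans _ h)// ler_wpM2l ?exprn_ge0// lerDl.
Qed.

(* Partial sums of the Neumann series: y_0 = 0 and y_(n+1) = x + T y_n. *)
Lemma neumann_solve T (q : R) : 0 <= q < 1 ->
  (forall x, nrm (T x) <= q * nrm x) -> forall x, exists y, y = x + T y.
Proof.
move=> /[dup] q01 /andP[q0 q1] Tq x.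
have q1' : 0 < 1 - q by rewrite subr_gt0.
pose y n := iter n (fun y => x + T y) 0.
(* The sum of the geometric series, and the fixed point of [s -> nrm x + q * s]; hence it bounds
   every partial sum. *)
pose D := nrm x / (1 - q).
have D0 : 0 <= D by rewrite divr_ge0 ?nrm_ge0// ltW.
have DE : nrm x + q * D = D by rewrite /D; field; rewrite lt0r_neq0.
have y_bnd n : nrm (y n) <= D.
  elim: n => [|n IH]; first by rewrite nrm0.
  rewrite -[in leRHS]DE (le_trans (nrmD _ _))// lerD2l.
  by rewrite (le_trans (Tq _))// ler_wpM2l.
have y_geo n k : nrm (y (n + k)%N - y n) <= q ^+ n * D.
  elim: n => [|n IH]; first by rewrite subr0 expr0 mul1r.
  rewrite addSn /= opprD addrACA subrr add0r -bop_raddfB exprS -mulrA.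
  by rewrite (le_trans (Tq _))// ler_wpM2l.
have [l hl] : exists l, forall e : R, 0 < e -> exists N, forall n, (N <= n)%N ->
    nrm (y n - l) <= e.
  apply: hilbert_complete => e e0.
  have [|N hN] := geometric_small q D (e / 2) q01 D0; first by rewrite divr_gt0.
  exists N => n k /subnKC <- /subnKC <-.
  rewrite -(subrKA (y N)) (le_trans (nrmD _ _))//.
  rewrite -[X in _ + X]nrmN opprB (splitr e).
  by rewrite lerD// (le_trans (y_geo _ _)).
exists l; apply/eqP; rewrite -subr_eq0; apply/eqP/nrm_small => e e0.
have [|N hN] := hl (e / 2); first by rewrite divr_gt0.
(* Since [y N.+1 = x + T (y N)], the residual of the limit consists of two approximation errors. *)
have -> : l - (x + T l) = T (y N - l) - (y N.+1 - l).
  rewrite /= bop_raddfB; move: (T l) (T (y N)) => b c.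
  by rewrite [RHS]addrC opprB (addrC x c) !opprD !addrA (addrAC l (- c)) subrK.
rewrite (le_trans (nrmB _ _))// (splitr e) lerD ?hN// (le_trans (Tq _))//.
by rewrite (le_trans _ (hN N (leqnn N)))// ler_piMl ?nrm_ge0 ?ltW.
Qed.

Definition invertible T := exists B, T * B = 1 /\ B * T = 1.

(** The lower bound makes [T] injective, so a chosen right inverse is linear and two-sided; the same
    bound makes it bounded. *)
Lemma bijective_invertible T (c : R) :
  (forall y, nrm y <= c * nrm (T y)) -> (forall x, exists y, T y = x) ->
  invertible T.
Proof.
move=> Tc surjT; have [g gK] := choice surjT.
have injT y z : T y = T z -> y = z.
  move=> Tyz; apply/eqP; rewrite -subr_eq0; apply/eqP/nrm_eq0/eqP.
  rewrite eq_le nrm_ge0 andbT (le_trans (Tc _))//.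
  by rewrite bop_raddfB Tyz subrr nrm0 mulr0.
have hg : g \in @bounded_op R H.
  apply/asboolP; split=> [a x y|]; first by apply: injT; rewrite bop_linear !gK.
  exists c => x; rewrite !normE -rmorphM lecR.
  by rewrite (le_trans (Tc _))// gK.
exists (exist _ g hg); split; apply: bopP => x; first exact: gK.
by apply: injT; exact: gK.
Qed.

(** Neumann series for [1 - c T]: a solution of [y = c x + (1 - c T) y] satisfies [T y = x], and the
    contraction bounds [T] from below. *)
Lemma near_scalar_invertible T (c q : R) : 0 < c -> 0 <= q < 1 ->
  (forall x, nrm (x - c%:C *: T x) <= q * nrm x) -> invertible T.
Proof.
move=> c0 /[dup] q01 /andP[q0 q1] Tq.
have q1' : 0 < 1 - q by rewrite subr_gt0.
apply: (@bijective_invertible _ (c / (1 - q))) => [y|x].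
  rewrite -mulrA mulrCA ler_pdivlMl// mulrBl mul1r lerBlDl.
  have -> : c * nrm (T y) = nrm (c%:C *: T y) by rewrite nrmZ gtr0_norm.
  rewrite -[in leLHS](subrK (c%:C *: T y) y) (le_trans (nrmD _ _))//.
  by rewrite lerD2r.
have [y hy] := @neumann_solve (1 - c%:C *: T) q q01 Tq (c%:C *: x).
exists y; move: hy; rewrite !bopE => /eqP.
rewrite addrCA -subr_eq0 opprD addrA subrr add0r oppr_eq0 -scalerBr scaler_eq0.
rewrite -(rmorph0 (real_complex R)) (inj_eq (@complexI R)) gt_eqF//= subr_eq0.
by move=> /eqP.
Qed.

(** With [C] from [positive_bound] and step [i = 1 / (C + c)], the squared norm of [x - i S x] is at
    most [rdot x x - i * rdot (S x) x], hence at most [(1 - c / (C + c)) * rdot x x]. So [1 - i S]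
    is a contraction. *)
Lemma coercive_invertible S (c : R) : selfadjoint S -> 0 < c ->
  (forall x, c * rdot x x <= rdot (S x) x) -> invertible S.
Proof.
move=> sS c0 Sc.
have pS : positive_op S.
  apply/positive_opP; split=> // x; rewrite (le_trans _ (Sc x))//.
  by rewrite mulr_ge0 ?rdot_ge0// ltW.
have [C C0 SC] := positive_bound S pS.
have D0 : 0 < C + c by rewrite addr_gt0.
have Di : 0 < (C + c)^-1 by rewrite invr_gt0.
have q1 : 1 - c / (C + c) = C / (C + c) by field; rewrite lt0r_neq0.
apply: (@near_scalar_invertible _ (C + c)^-1 (Num.sqrt (1 - c / (C + c)))) => //.
  rewrite sqrtr_ge0 -[ltRHS]sqrtr1 ltr_sqrt// gtrBl.
  by rewrite divr_gt0.
move=> x; apply: nrm_le; first exact: sqrtr_ge0.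
rewrite sqr_sqrtr; last by rewrite q1 divr_ge0 ?ltW.
rewrite !rdotBl !rdotBr !rdotZl !rdotZr (rdotC x (S x)).
have h1 := Sc x; have h2 := SC x.
set n := rdot x x in h1 *; set r := rdot (S x) x in h1 h2 *.
set s := rdot (S x) (S x) in h2 *.
have r0 : 0 <= r by move/positive_opP : pS => [_ ->].
have h3 : (C + c)^-1 * s <= r.
  by rewrite ler_pdivrMl// (le_trans h2)// ler_wpM2r// lerDl ltW.
have {}h1 : (C + c)^-1 * (c * n) <= (C + c)^-1 * r by rewrite ler_pM2l.
have {}h3 : (C + c)^-1 * ((C + c)^-1 * s) <= (C + c)^-1 * r by rewrite ler_pM2l.
rewrite (mulrC c); move: h1 h3; set i := (C + c)^-1; clearbody i.
lra.
Qed.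

(* If s is the infimum of the numerical range and T - s is invertible, then
   [positive_bound] makes T - s coercive, so s could be increased. *)
Lemma positive_of_invertible T : selfadjoint T ->
  (forall t : R, t < 0 -> invertible (T - scalar_op t%:C)) -> positive_op T.
Proof.
move=> sT invT; apply/positive_opP; split=> // x0; rewrite leNgt.
apply/negP => Tx0.
(* The lower bounds of the numerical range; the supremum of [E] is the infimum of that range and
   belongs to [E]. *)
pose E := [set a : R | forall x, a * rdot x x <= rdot (T x) x].
have [c c0 Tc] := bop_bounded T.
have Ec : E (- c).
  move=> x /=; rewrite mulNr rdot_nrm expr2 mulrA; apply: lerNnormlW.
  rewrite (le_trans (abs_rdot_le_nrm _ _))//.
  by rewrite ler_wpM2r ?nrm_ge0.
have n0 : 0 < rdot x0 x0.
  rewrite lt_neqAle rdot_ge0 andbT eq_sym; apply/eqP => n0.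
  move: Tx0; rewrite (_ : x0 = 0); last first.
    by apply: nrm_eq0; apply/eqP; rewrite -sqrf_eq0 -rdot_nrm n0.
  by rewrite bop_raddf0 /rdot linear0l ltxx.
have ubE : ubound E (rdot (T x0) x0 / rdot x0 x0).
  by move=> a /(_ x0); rewrite ler_pdivlMr.
pose s := sup E.
have s0 : s < 0.
  apply: (@le_lt_trans _ _ (rdot (T x0) x0 / rdot x0 x0)).
    by apply: ge_sup => //; exists (- c).
  by rewrite pmulr_llt0 ?invr_gt0.
have Es : E s.
  move=> x; have [|n1] := leP (rdot x x) 0.
    rewrite le_eqVlt ltNge rdot_ge0 orbF => /eqP n1; rewrite n1 mulr0.
    by have := Ec x; rewrite n1 mulr0.
  rewrite -ler_pdivlMr//; apply: ge_sup; first by exists (- c).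
  by move=> a /(_ x); rewrite ler_pdivlMr.
have sP x y : rdot ((T - scalar_op s%:C : bop H) x) y = rdot (T x) y - s * rdot x y.
  by rewrite !bopE rdotBl rdotZl.
have pP : positive_op (T - scalar_op s%:C).
  apply/positive_opP; split=> [|x]; last by rewrite sP subr_ge0; exact: Es.
  apply/selfadjointP => x y; rewrite sP [RHS]rdotC sP.
  by rewrite (rdotC y x) (rdotC _ x) (proj1 (selfadjointP T) sT).
have [C C0 PC] := positive_bound _ pP.
have [Q [_ QP]] := invT _ s0.
have [N N0 QN] := bop_bounded Q.
have K0 : 0 < N ^+ 2 * C by rewrite mulr_gt0 ?exprn_gt0.
(* The inverse [Q] bounds [x] by [N] times [(T - s) x], and [positive_bound] bounds the latter by
   the form of [T - s]. So this form is at least [rdot x x / (N ^+ 2 * C)]. *)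
have : E (s + (N ^+ 2 * C)^-1).
  move=> x; rewrite mulrDl -lerBrDl -sP ler_pdivrMl// -mulrA.
  have xE : x = (Q : bop H) ((T - scalar_op s%:C : bop H) x) by rewrite -bopME QP.
  apply: (@le_trans _ _ (N ^+ 2 * nrm ((T - scalar_op s%:C : bop H) x) ^+ 2)).
    rewrite rdot_nrm -exprMn ler_sqr ?nnegrE ?nrm_ge0 ?mulr_ge0 ?nrm_ge0 ?(ltW N0)//.
    by rewrite [in leLHS]xE.
  by rewrite ler_wpM2l ?sqr_ge0// -rdot_nrm.
move/(ub_le_sup (ex_intro _ _ ubE)); rewrite -/s gerDl leNgt invr_gt0 K0//.
Qed.

End Invertibility.

(** * Polynomials of an operator *)

Section PolynomialCalculus.
Context {R : realType} {H : hilbertType R}.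
Implicit Types (x y : H) (A T S : bop H) (p q : {poly R}) (P Q : {poly R[i]}).

(** Complex coefficients let a real polynomial of [A] be split into linear factors; [poly_opE]
    embeds the real calculus here. *)
Definition cpoly_op P A : bop H := \sum_(i < size P) P`_i *: (A ^+ i : bop H).

Lemma cpoly_op_widen n P A : (size P <= n)%N ->
  cpoly_op P A = \sum_(i < n) P`_i *: (A ^+ i : bop H).
Proof.
move=> sPn; rewrite /cpoly_op (big_ord_widen n (fun i => P`_i *: (A ^+ i : bop H)))//.
rewrite big_mkcond /=; apply: eq_bigr => i _.
by case: ltnP => // si; rewrite nth_default// scale0r.
Qed.

Lemma cpoly_opD P Q A : cpoly_op (P + Q) A = cpoly_op P A + cpoly_op Q A.
Proof.
rewrite (cpoly_op_widen _ _ _ (size_polyD P Q)).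
rewrite (cpoly_op_widen _ P A (leq_maxl _ (size Q))).
rewrite (cpoly_op_widen _ Q A (leq_maxr (size P) _)) -big_split.
by apply: eq_bigr => i _ /=; rewrite coefD scalerDl.
Qed.

Lemma cpoly_opC (c : R[i]) A : cpoly_op c%:P A = c *: (1 : bop H).
Proof.
rewrite (cpoly_op_widen 1) ?size_polyC ?leq_b1// big_ord_recl big_ord0 addr0.
by rewrite coefC expr0.
Qed.

Lemma cpoly_opMX P A : cpoly_op (P * 'X) A = cpoly_op P A * A.
Proof.
have s : (size (P * 'X)%R <= (size P).+1)%N.
  by rewrite (leq_trans (size_polyMleq _ _))// size_polyX addn2.
rewrite (cpoly_op_widen _ _ _ s) big_ord_recl coefMX eqxx scale0r add0r.
rewrite /cpoly_op mulr_suml; apply: eq_bigr => i _.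
by rewrite coefMX /= exprSr bop_scalerAl.
Qed.

Lemma cpoly_opX A : cpoly_op 'X A = A.
Proof. by rewrite -[X in cpoly_op X]mul1r cpoly_opMX cpoly_opC scale1r mul1r. Qed.

Lemma cpoly_opZ (c : R[i]) P A : cpoly_op (c *: P) A = c *: cpoly_op P A.
Proof.
rewrite (cpoly_op_widen _ _ _ (size_scale_leq c P)) /cpoly_op scaler_sumr.
by apply: eq_bigr => i _; rewrite coefZ scalerA.
Qed.

Lemma cpoly_opM P Q A : cpoly_op (P * Q) A = cpoly_op P A * cpoly_op Q A.
Proof.
elim/poly_ind: Q => [|Q c IH].
  by rewrite mulr0 -polyC0 cpoly_opC scale0r mulr0.
rewrite mulrDr mulrA !cpoly_opD !cpoly_opMX IH mulrDr mulrA; congr (_ + _).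
by rewrite mulrC mul_polyC cpoly_opZ cpoly_opC bop_scalerAr mulr1.
Qed.

Lemma poly_opE p A : poly_op p A = cpoly_op (map_poly (real_complex R) p) A.
Proof.
rewrite /cpoly_op size_map_poly; apply: eq_bigr => i _.
by rewrite coef_map.
Qed.

Lemma poly_opD p q A : poly_op (p + q) A = poly_op p A + poly_op q A.
Proof. by rewrite !poly_opE rmorphD cpoly_opD. Qed.

Lemma poly_opZ (c : R) p A : poly_op (c *: p) A = c%:C *: poly_op p A.
Proof. by rewrite !poly_opE map_polyZ cpoly_opZ. Qed.

Lemma poly_opN p A : poly_op (- p) A = - poly_op p A.
Proof. by rewrite -scaleN1r poly_opZ rmorphN1 scaleN1r. Qed.

Lemma poly_opB p q A : poly_op (p - q) A = poly_op p A - poly_op q A.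
Proof. by rewrite poly_opD poly_opN. Qed.

Lemma poly_opC (c : R) A : poly_op c%:P A = scalar_op c%:C.
Proof. by rewrite !poly_opE map_polyC cpoly_opC. Qed.

Lemma poly_opX A : poly_op 'X A = A.
Proof. by rewrite !poly_opE map_polyX cpoly_opX. Qed.

Lemma poly_opM p q A : poly_op (p * q) A = poly_op p A * poly_op q A.
Proof. by rewrite !poly_opE rmorphM cpoly_opM. Qed.

Lemma poly_op_selfadjoint p A : selfadjoint A -> selfadjoint (poly_op p A).
Proof.
move=> /selfadjointP sA; apply/selfadjointP.
elim/poly_ind: p => [|p c IH] x y.
  by rewrite -polyC0 poly_opC !bopE !rdotZl !rdotZr !mul0r.
rewrite poly_opD poly_opC !bopE rdotDl rdotDr rdotZl rdotZr; congr (_ + _).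
(* Swapping the factors on one side only places [A] so that it can move across the inner product
   after the polynomial does. *)
rewrite {2}mulrC !poly_opM poly_opX !bopME.
by rewrite IH sA.
Qed.

Lemma invertible1 : invertible (1 : bop H).
Proof. by exists 1; rewrite mul1r. Qed.

Lemma invertibleM T S : invertible T -> invertible S -> invertible (T * S).
Proof.
move=> [T' [TT' T'T]] [S' [SS' S'S]]; exists (S' * T'); split.
  by rewrite mulrA -(mulrA T) SS' mulr1.
by rewrite mulrA -(mulrA S') T'T mulr1.
Qed.

Lemma invertibleZ (c : R[i]) T : c != 0 -> invertible T -> invertible (c *: T).
Proof.
move=> c0 [T' [TT' T'T]]; exists (c^-1 *: T').
by rewrite !bop_scalerAl !bop_scalerAr !scalerA TT' T'T mulfV ?mulVf ?scale1r.
Qed.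

(* (A - z)(A - conj z) = (A - a)^2 + b^2 is coercive for z = a + i b. *)
Lemma nonreal_invertible A (z : R[i]) : selfadjoint A -> complex.Im z != 0 ->
  invertible (A - scalar_op z).
Proof.
move=> sA; case: z => a b /= b0.
pose P : {poly R} := ('X - a%:P) ^+ 2 + (b ^+ 2)%:P.
have [V [PV VP]] : invertible (poly_op P A).
  apply: (@coercive_invertible _ _ _ (b ^+ 2)).
  - exact: poly_op_selfadjoint.
  - by rewrite exprn_even_gt0.
  move=> x; rewrite poly_opD poly_opC !bopE rdotDl rdotZl lerDr.
  rewrite expr2 poly_opM bopME.
  have /selfadjointP -> := @poly_op_selfadjoint ('X - a%:P) A sA.
  exact: rdot_ge0.
have PE : map_poly (real_complex R) P =
    ('X - (a +i* b)%:P) * ('X - (a -i* b)%:P).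
  rewrite /P rmorphD rmorphXn rmorphB /= map_polyX !map_polyC /=.
  rewrite (_ : a +i* b = a%:C + 'i * b%:C); last by simpc.
  rewrite (_ : a -i* b = a%:C - 'i * b%:C); last by simpc.
  rewrite !rmorphB !rmorphD !rmorphM /= [X in _ + X](_ : _ = - ('i%:P * b%:C%:P) ^+ 2).
    ring.
  rewrite -expr2 -[in RHS]polyCM -!polyC_exp -polyCN; congr (_%:P).
  by rewrite exprMn sqr_i mulN1r opprK.
have opE (w : R[i]) : cpoly_op ('X - w%:P) A = A - scalar_op w.
  by rewrite cpoly_opD -polyCN cpoly_opX cpoly_opC scaleNr.
pose T := A - scalar_op (a +i* b); pose S := A - scalar_op (a -i* b).
have TS : T * S = poly_op P A by rewrite poly_opE PE cpoly_opM !opE.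
have ST : S * T = poly_op P A by rewrite poly_opE PE mulrC cpoly_opM !opE.
(* [S * V] is a right inverse of [T] and [V * S] a left inverse, so they coincide. *)
have VS : V * S = S * V.
  by rewrite -[LHS]mulr1 -PV -TS -!mulrA (mulrA S T) ST (mulrA V) VP mul1r.
exists (S * V); rewrite mulrA TS PV; split=> //.
by rewrite -VS -mulrA ST VP.
Qed.

(** Each linear factor over [R[i]] is invertible at [A]: for a nonreal root by [nonreal_invertible],
    for a real root because it lies off the spectrum. *)
Lemma poly_op_invertible A p : selfadjoint A -> p != 0 ->
  (forall t : R, spectrum A t%:C -> p.[t] != 0) -> invertible (poly_op p A).
Proof.
move=> sA p0 pA; rewrite poly_opE.
have [r rE] := closed_field_poly_normal (map_poly (real_complex R) p).
have rp z : z \in r -> root (map_poly (real_complex R) p) z.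
  by move=> zr; rewrite rE rootZ ?lead_coef_eq0 ?map_poly_eq0// root_prod_XsubC.
rewrite [X in cpoly_op X]rE cpoly_opZ; apply: invertibleZ.
  by rewrite lead_coef_eq0 map_poly_eq0.
elim: r rp {rE} => [|z r IH] rp.
  by rewrite big_nil -polyC1 cpoly_opC scale1r; exact: invertible1.
rewrite big_cons cpoly_opM; apply: invertibleM; last first.
  by apply: IH => w wr; apply: rp; rewrite in_cons wr orbT.
have zp : root (map_poly (real_complex R) p) z by apply: rp; rewrite mem_head.
rewrite cpoly_opD -polyCN cpoly_opX cpoly_opC scaleNr.
have [z0|] := eqVneq (complex.Im z) 0; last exact: nonreal_invertible.
have zE : z = (complex.Re z)%:C by case: z z0 {zp rp} => ? ? /= ->.
apply: contrapT => nz; have := pA (complex.Re z); rewrite -zE => /(_ nz).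
by move: zp; rewrite zE /root horner_map fmorph_eq0 => ->.
Qed.

(** Without real spectrum [A - c] is positive for every real [c], however large, which leaves no
    nonzero vector. *)
Lemma spectrum_empty A : selfadjoint A -> (forall t : R, ~ spectrum A t%:C) ->
  forall x, x = 0.
Proof.
move=> sA Ae x.
have pA c : positive_op (A - scalar_op c%:C).
  have cE t : A - scalar_op c%:C - scalar_op t%:C = A - scalar_op (c + t)%:C.
    by rewrite rmorphD /scalar_op scalerDl opprD addrA.
  apply: positive_of_invertible => [|t _].
    rewrite -(poly_opC _ A) -{1}[A]poly_opX -poly_opB.
    exact: poly_op_selfadjoint.
  by rewrite cE; apply: contrapT => h; exact: (Ae (c + t)).
apply/nrm_eq0/eqP; rewrite -sqrf_eq0 -rdot_nrm eq_le rdot_ge0 andbT.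
(* This shift exceeds the Rayleigh quotient at [x] by at least one. *)
have /positive_opP[_ /(_ x)] := pA (1 + `|rdot (A x) x| / rdot x x).
rewrite !bopE rdotBl rdotZl; have [//|n0] := leP (rdot x x) 0.
rewrite mulrDl mul1r divfK ?lt0r_neq0// => h.
by have := ler_norm (rdot (A x) x); lra.
Qed.

Lemma poly_op_positive A p : selfadjoint A ->
  (forall t : R, spectrum A t%:C -> 0 <= p.[t]) -> positive_op (poly_op p A).
Proof.
move=> sA pA.
(* A spectral point [t0] is what shows that [p - t] is not the zero polynomial; with no such point
   the space is zero. *)
have [Ae|] := pselect (forall t : R, ~ spectrum A t%:C).
  by move=> x; rewrite [x](spectrum_empty _ sA Ae) linear0r.
move=> /existsNP[t0 /contrapT At0].
apply: positive_of_invertible => [|t t0']; first exact: poly_op_selfadjoint.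
have qp u : (p - t%:P).[u] = p.[u] - t by rewrite !hornerE.
rewrite -(poly_opC _ A) -poly_opB; apply: poly_op_invertible => // [|u Au].
  apply/eqP => q0; have := qp t0; rewrite q0 horner0 => h.
  by have := pA _ At0; lra.
rewrite qp; apply/eqP => h; have := pA _ Au; lra.
Qed.

End PolynomialCalculus.

(** * Continuous functional calculus *)

Section ContinuousCalculus.
Context {R : realType} {H : hilbertType R}.
Implicit Types (x y : H) (A B : bop H) (f : R -> R) (p q : {poly R}).

(** The polynomial [e ^+ 2 - p * p] is nonnegative on the spectrum, and the form of [p(A) * p(A)] at
    [x] is the squared norm of [p(A) x]. *)
Lemma poly_op_norm A p (e : R) : selfadjoint A -> 0 <= e ->
  (forall t : R, spectrum A t%:C -> `|p.[t]| <= e) ->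
  forall x, nrm (poly_op p A x) <= e * nrm x.
Proof.
move=> sA e0 pe x; apply: nrm_le => //.
have : positive_op (poly_op ((e ^+ 2)%:P - p * p) A).
  apply: poly_op_positive => // t /pe h.
  by rewrite !hornerE -expr2 subr_ge0 -real_normK ?num_real// lerXn2r.
move=> /positive_opP[_ /(_ x)].
rewrite poly_opB poly_opC poly_opM !bopE rdotBl rdotZl subr_ge0.
by have /selfadjointP -> := poly_op_selfadjoint p A sA.
Qed.

Lemma inv_small (D e : R) : 0 <= D -> 0 < e ->
  exists N, forall n, (N <= n)%N -> n.+1%:R^-1 * D <= e.
Proof.
move=> D0 e0.
have d0 : 0 < e / (D + 1) by rewrite divr_gt0 ?ltr_wpDl.
have [N _ hN] := near_infty_natSinv_lt (PosNum d0).
exists N => n /hN /= /ltW; rewrite ler_pdivlMr ?ltr_wpDl// => h.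
by rewrite (le_trans _ h)// ler_wpM2l ?invr_ge0// lerDl.
Qed.

(** By [poly_op_norm], polynomials uniformly Cauchy on the spectrum give operators that are Cauchy
    in norm; the limit is built pointwise. *)
Lemma cfc_exists f A : selfadjoint A ->
  (forall e : R, 0 < e -> exists p : {poly R},
    forall t : R, spectrum A t%:C -> `|p.[t] - f t| <= e) ->
  exists B, is_cfc f A B.
Proof.
move=> sA fA.
pose r n : R := n.+1%:R^-1.
have r0 n : 0 < r n by rewrite invr_gt0.
have r_anti n k : (n <= k)%N -> r k <= r n.
  by move=> nk; rewrite lef_pV2 ?posrE// ler_nat ltnS.
have [p hp] := choice (fun n => fA (r n) (r0 n)).
pose P n : bop H := poly_op (p n) A.
have PP x n k : nrm (P n x - P k x) <= (r n + r k) * nrm x.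
  rewrite -bopBE -poly_opB; apply: poly_op_norm => // [|t At].
    by rewrite addr_ge0 ?ltW.
  rewrite hornerD hornerN -(subrKA (f t)) (le_trans (ler_normD _ _))//.
  by rewrite lerD ?hp// distrC hp.
(* Choosing the limit together with its rate yields boundedness (at [n = 0]), linearity and norm
   convergence. *)
have [|g hg] := @choice H H (fun x l => forall n, nrm (P n x - l) <= 2 * r n * nrm x).
  move=> x; have [|l hl] := hilbert_complete (P ^~ x).
    move=> e e0; have [|N hN] := inv_small (2 * nrm x) e _ e0.
      by rewrite mulr_ge0 ?nrm_ge0.
    exists N => n k Nn Nk; rewrite (le_trans (PP _ _ _))// (le_trans _ (hN _ (leqnn N)))//.
    rewrite mulrCA mulrA ler_wpM2r ?nrm_ge0// -/(r N) mulr_natl mulr2n.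
    by rewrite lerD ?r_anti.
  exists l => n; apply/ler_addgt0Pr => e e0; have [N hN] := hl _ e0.
  rewrite -(subrKA (P (maxn n N) x)) (le_trans (nrmD _ _))//.
  rewrite lerD ?hN ?leq_maxr// (le_trans (PP _ _ _))// ler_wpM2r ?nrm_ge0//.
  by rewrite mulr_natl mulr2n lerD2l r_anti ?leq_maxl.
have hgC x n : `|P n x - g x| <= (2 * r n)%:C * `|x|.
  by rewrite !normE -rmorphM lecR.
have gb : g \in @bounded_op R H.
  apply/asboolP; split=> [a x y|]; last first.
    have [c c0 hc] := bop_bounded (P 0); exists (c + 2 * r 0) => x.
    rewrite !normE -rmorphM lecR mulrDl -(subKr (P 0 x) (g x)).
    by rewrite (le_trans (nrmB _ _))// lerD.
  apply/eqP; rewrite -subr_eq0; apply/eqP/nrm_small => e e0.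
  pose D := nrm (a *: x + y) + nrm (a *: x) + nrm y.
  have [|N hN] := inv_small (2 * D) e _ e0.
    by rewrite mulr_ge0// !addr_ge0 ?nrm_ge0.
  have {hN} := hN _ (leqnn N); rewrite -/(r N) => /(le_trans _); apply.
  (* [P N] is linear, so the linearity defect of [g] is a combination of three errors of [P N]. *)
  have -> : g (a *: x + y) - (a *: g x + g y) =
      a *: (P N x - g x) + (P N y - g y) - (P N (a *: x + y) - g (a *: x + y)).
    rewrite bop_linear scalerBr; move: (g (a *: x + y)) => w.
    move: (a *: P N x) (a *: g x) (P N y) (g y) => u u' v v'.
    by rewrite [u - u' + _]addrACA opprB [RHS]addrC addrA subrK opprD.
  have nZ z : nrm (a *: z) = complex.Re `|a| * nrm z.
    by rewrite /nrm normrZ [X in _ * X]normE mulrC ReZ mulrC.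
  have hx : nrm (a *: (P N x - g x)) <= 2 * r N * nrm (a *: x).
    rewrite !nZ mulrCA ler_wpM2l ?hg//.
    by have := normr_ge0 a; rewrite lecE => /andP[].
  rewrite (le_trans (nrmB _ _))//.
  have := nrmD (a *: (P N x - g x)) (P N y - g y).
  by have := hg y N; have := hg (a *: x + y) N; rewrite /D; lra.
exists (exist _ g gb), p; split=> e e0.
  have [|N hN] := inv_small 1 e _ e0; first by [].
  exists N => // n /= Nn t At; rewrite (le_trans (hp n t At))//.
  by have := hN n Nn; rewrite mulr1.
have [|N hN] := inv_small 2 e _ e0; first by [].
exists N => // n /= Nn x; rewrite (le_trans (hgC x n))// ler_wpM2r// lecR.
by rewrite mulrC hN.
Qed.

Lemma is_cfc_approx f A B (e : R) : is_cfc f A B -> 0 < e -> exists p,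
  (forall t : R, spectrum A t%:C -> `|p.[t] - f t| <= e) /\
  (forall x, nrm (poly_op p A x - B x) <= e * nrm x).
Proof.
move=> [p [pf pB]] e0; have [n [h1 h2]] := filter_ex (filterI (pf e e0) (pB e e0)).
exists (p n); split=> // x; have := h2 x.
by rewrite !normE -rmorphM lecR.
Qed.

Lemma is_cfc_selfadjoint f A B : selfadjoint A -> is_cfc f A B -> selfadjoint B.
Proof.
move=> sA fB; apply/selfadjointP => x y; apply/eqP; rewrite -subr_eq0 -normr_le0.
apply/ler_addgt0Pr => e e0; rewrite add0r.
pose D := 2 * (nrm x * nrm y).
have D0 : 0 <= D by rewrite !mulr_ge0 ?nrm_ge0.
have d0 : 0 < e / (D + 1) by rewrite divr_gt0 ?ltr_wpDl.
have de : e / (D + 1) * D <= e.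
  by rewrite mulrAC ler_pdivrMr ?ltr_wpDl// ler_wpM2l ?(ltW e0)// lerDl.
have [p [_ pB]] := is_cfc_approx _ _ _ _ fB d0.
have /selfadjointP sp := poly_op_selfadjoint p A sA.
have -> : rdot (B x) y - rdot x (B y) =
    rdot x (poly_op p A y - B y) - rdot (poly_op p A x - B x) y.
  by rewrite rdotBl rdotBr sp; ring.
rewrite (le_trans (ler_normB _ _))// (le_trans _ de)//.
have /le_trans hx := abs_rdot_le_nrm x (poly_op p A y - B y).
have /le_trans hy := abs_rdot_le_nrm (poly_op p A x - B x) y.
have {}hx := hx _ (ler_wpM2l (nrm_ge0 x) (pB y)).
have {}hy := hy _ (ler_wpM2r (nrm_ge0 y) (pB x)).
by rewrite /D; move: hx hy; rewrite /D; set d := e / _; clearbody d; lra.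
Qed.

Lemma is_cfcN f A B : is_cfc f A B -> is_cfc (fun t => - f t) A (- B).
Proof.
move=> [p [pf pB]]; exists (fun n => - p n); split=> e e0.
  apply: filterS (pf e e0) => n h t At.
  by rewrite hornerN -opprD normrN h.
apply: filterS (pB e e0) => n h x.
by rewrite poly_opN !bopE -opprD normrN h.
Qed.

(** If [p] is [d]-close to [f] on the spectrum, then [q + d - p] is nonnegative there, and
    [poly_op_positive] applies to it. *)
Lemma is_cfc_le f A B q : selfadjoint A -> is_cfc f A B ->
  (forall t : R, spectrum A t%:C -> f t <= q.[t]) -> B <=L poly_op q A.
Proof.
move=> sA fB fq; apply/positive_opP; split=> [|x].
  have /selfadjointP sB := is_cfc_selfadjoint _ _ _ sA fB.
  have /selfadjointP sq := poly_op_selfadjoint q A sA.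
  by apply/selfadjointP => x y; rewrite !bopE rdotBl rdotBr sB sq.
rewrite !bopE rdotBl subr_ge0; apply/ler_addgt0Pr => e e0.
(* Two errors of size [d * rdot x x] occur: the shift by [d], and the replacement of [B] by
   [p(A)]. *)
have n0 := rdot_ge0 x; pose d := e / 2 / (rdot x x + 1).
have d0 : 0 < d by rewrite !divr_gt0 ?ltr_wpDl.
have [p [pf pB]] := is_cfc_approx _ _ _ d fB d0.
have : positive_op (poly_op (q + d%:P - p) A).
  apply: poly_op_positive => // t At; rewrite !hornerE.
  by have := pf t At; have := fq t At; rewrite ler_norml => ? /andP[]; lra.
move=> /positive_opP[_ /(_ x)].
rewrite poly_opB poly_opD poly_opC !bopE rdotBl rdotDl rdotZl.
have := abs_rdot_le_nrm (poly_op p A x - B x) x.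
have : nrm (poly_op p A x - B x) * nrm x <= d * rdot x x.
  by rewrite rdot_nrm expr2 mulrA ler_wpM2r ?nrm_ge0.
have : d * rdot x x <= e / 2.
  rewrite /d mulrAC ler_pdivrMr ?ltr_wpDl// ler_wpM2l ?lerDl//.
  by rewrite ltW ?divr_gt0.
by rewrite rdotBl ler_norml => ? ? /andP[]; lra.
Qed.

Lemma is_cfc_ge f A B q : selfadjoint A -> is_cfc f A B ->
  (forall t : R, spectrum A t%:C -> q.[t] <= f t) -> poly_op q A <=L B.
Proof.
move=> sA /is_cfcN fB qf; rewrite /loewner_le -[B]opprK addrC -poly_opN.
by apply: is_cfc_le fB _ => // t At; rewrite hornerN lerN2 qf.
Qed.

End ContinuousCalculus.

(** * Taylor and chord bounds *)

Section TaylorBounds.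
Context {R : realType}.
Implicit Types (I : set R) (f : R -> R).

Lemma has_derivative_withinP I f (x l : R) : has_derivative_within I f x l <->
  forall e : R, 0 < e -> exists2 d : R, 0 < d &
    forall y, I y -> y != x -> `|y - x| < d -> `|(f y - f x) / (y - x) - l| <= e.
Proof.
split=> [/cvgrPdist_le h e e0|h].
  have /nbhs_ballP[d /= d0 hd] := h e e0.
  exists d => // y Iy yx yd; rewrite distrC.
  by apply: hd => //; rewrite /ball /= distrC.
apply/cvgrPdist_le => e e0; have [d d0 hd] := h e e0.
apply/nbhs_ballP; exists d => // y; rewrite /ball /= distrC => yd yx Iy.
by rewrite distrC hd.
Qed.

Lemma has_derivative_withinN I f (x l : R) : has_derivative_within I f x l ->
  has_derivative_within I (fun y => - f y) x (- l).
Proof.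
move=> /has_derivative_withinP h; apply/has_derivative_withinP => e e0.
have [d d0 hd] := h e e0; exists d => // y Iy yx yd.
have -> : (- f y - - f x) / (y - x) - - l = - ((f y - f x) / (y - x) - l) by ring.
by rewrite normrN hd.
Qed.

Lemma has_derivative_within_lip I f (x l : R) : has_derivative_within I f x l ->
  exists2 d : R, 0 < d & forall y, I y -> `|y - x| < d ->
    `|f y - f x| <= (`|l| + 1) * `|y - x|.
Proof.
move=> /has_derivative_withinP/(_ 1 ltr01)[d d0 hd]; exists d => // y Iy yd.
have [->|yx] := eqVneq y x; first by rewrite !subrr normr0 mulr0.
have yx0 : 0 < `|y - x| by rewrite normr_gt0 subr_eq0.
rewrite -ler_pdivrMr// -normf_div -lerBlDl.
by rewrite (le_trans (lerB_dist _ _))// hd.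
Qed.

(** Inside []a, b[] the derivative within [I] is an ordinary derivative. Continuity on [[a, b]],
    endpoints included, comes from the local Lipschitz bound. *)
Lemma mean_value_within I f f' : is_interval I ->
  (forall x, I x -> has_derivative_within I f x (f' x)) ->
  forall a b, I a -> I b -> a < b ->
  exists2 c, a < c < b & f b - f a = f' c * (b - a).
Proof.
move=> itvI der a b Ia Ib ab.
have Iab x : a <= x <= b -> I x by exact: itvI.
have [||c cab fE] := @MVT _ f f' a b ab.
- move=> x; rewrite in_itv /= => /andP[ax xb].
  have Ix : I x by apply: Iab; rewrite !ltW.
  have h : (fun t : R => t^-1 *: ((f \o shift x) (t *: (1 : R)) - f x)) @ 0^' --> f' x.
    apply/cvgrPdist_le => e e0.
    have /has_derivative_withinP/(_ e e0)[d d0 hd] := der x Ix.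
    (* The last two terms keep [t + x] inside [[a, b]]. *)
    have d1 : 0 < Num.min d (Num.min (x - a) (b - x)).
      by rewrite !lt_min d0 !subr_gt0 ax.
    apply/nbhs_ballP; exists (Num.min d (Num.min (x - a) (b - x))) => // t.
    rewrite /ball /= sub0r normrN !lt_min => /and3P[td ta tb] t0.
    rewrite distrC /shift /= /GRing.scale /= mulr1 mulrC.
    have := hd (t + x); rewrite addrK; apply.
    - apply: Iab; move: ta tb; rewrite !ltr_norml => /andP[? ?] /andP[? ?].
      by apply/andP; split; lra.
    - by rewrite -subr_eq0 addrK.
    - by [].
  apply: DeriveDef; first by apply/cvg_ex; exists (f' x).
  exact/cvg_lim.
- apply/subspace_continuousP => x; rewrite /= in_itv /= => xab.
  apply/cvgrPdist_le => e e0.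
  have [d d0 hd] := has_derivative_within_lip _ _ _ _ (der x (Iab x xab)).
  have K0 : 0 < `|f' x| + 1 by rewrite ltr_wpDl.
  apply/nbhs_ballP; exists (Num.min d (e / (`|f' x| + 1))).
    by rewrite /= lt_min d0 divr_gt0.
  move=> y; rewrite /ball /= distrC lt_min => /andP[yd ye].
  rewrite in_itv /= => yab.
  rewrite distrC (le_trans (hd y (Iab y yab) yd))// mulrC.
  by rewrite -ler_pdivlMr// ltW.
by exists c => //; move: cab; rewrite in_itv.
Qed.

(** The positive product records that [c] lies on the same side of [x] as [y], whichever way they
    are ordered. *)
Lemma mean_value_within_neq I f f' : is_interval I ->
  (forall x, I x -> has_derivative_within I f x (f' x)) ->
  forall x y, I x -> I y -> x != y ->
  exists c, [/\ I c, 0 < (c - x) * (y - x) & f y - f x = f' c * (y - x)].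
Proof.
move=> itvI der x y Ix Iy; rewrite neq_lt => /orP[xy|yx].
  have [c /andP[xc cy] h] := mean_value_within _ _ _ itvI der x y Ix Iy xy.
  exists c; split=> //; first by apply: (itvI x y) => //; rewrite !ltW.
  by rewrite mulr_gt0// subr_gt0.
have [c /andP[yc cx] h] := mean_value_within _ _ _ itvI der y x Iy Ix yx.
exists c; split; first by apply: (itvI y x) => //; rewrite !ltW.
  by rewrite nmulr_rgt0 subr_lt0.
by rewrite -opprB h; ring.
Qed.

(** Two mean value steps turn the increment of [g] into [(f'' k - b) * (c - x) * (y - x)], where the
    last two factors have a positive product. *)
Lemma taylor_upper I f f' f'' (b : R) : is_interval I ->
  (forall x, I x -> has_derivative_within I f x (f' x)) ->
  (forall x, I x -> has_derivative_within I f' x (f'' x)) ->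
  (forall x, I x -> f'' x <= b) ->
  forall x y, I x -> I y -> f y - f x - f' x * (y - x) <= b / 2 * (y - x) ^+ 2.
Proof.
move=> itvI der der' fb x y Ix Iy.
have [->|xy] := eqVneq x y; first by rewrite !subrr expr0n !mulr0 subrr.
pose g z := f z - f' x * (z - x) - b / 2 * (z - x) ^+ 2.
pose g' z := f' z - f' x - b * (z - x).
have derg z : I z -> has_derivative_within I g z (g' z).
  move=> Iz; apply/has_derivative_withinP => e e0.
  have e20 : 0 < e / 2 by rewrite divr_gt0.
  have /has_derivative_withinP/(_ _ e20)[d d0 hd] := der z Iz.
  have K0 : 0 < `|b| + 1 by rewrite ltr_wpDl.
  exists (Num.min d (e / (`|b| + 1))); first by rewrite lt_min d0 divr_gt0.
  move=> w Iw wz; rewrite lt_min => /andP[wd we].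
  have wz0 : w - z != 0 by rewrite subr_eq0.
  have -> : (g w - g z) / (w - z) - g' z =
      ((f w - f z) / (w - z) - f' z) - b / 2 * (w - z).
    by rewrite /g /g'; field.
  rewrite (le_trans (ler_normB _ _))// (splitr e) lerD ?hd//.
  move: we; rewrite ltr_pdivlMr// => we.
  rewrite mulrAC normrM (ger0_norm (_ : 0 <= 2^-1)) ?invr_ge0// ler_wpM2r ?invr_ge0//.
  by rewrite normrM mulrC (le_trans _ (ltW we))// ler_wpM2l// lerDl.
have [c [Ic cx gE]] := mean_value_within_neq _ _ _ itvI derg _ _ Ix Iy xy.
have cx0 : c - x != 0 by apply: contraTneq cx => ->; rewrite mul0r ltxx.
have xc : x != c by rewrite eq_sym -subr_eq0.
have [k [Ik _ fE]] := mean_value_within_neq _ _ _ itvI der' _ _ Ix Ic xc.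
have : g y - g x <= 0.
  rewrite gE /g' fE -mulrBl -mulrA.
  by rewrite mulr_le0_ge0 ?(ltW cx)// subr_le0 fb.
by rewrite /g; lra.
Qed.

Lemma taylor_lower I f f' f'' (a : R) : is_interval I ->
  (forall x, I x -> has_derivative_within I f x (f' x)) ->
  (forall x, I x -> has_derivative_within I f' x (f'' x)) ->
  (forall x, I x -> a <= f'' x) ->
  forall x y, I x -> I y -> a / 2 * (y - x) ^+ 2 <= f y - f x - f' x * (y - x).
Proof.
move=> itvI der der' fa x y Ix Iy.
have h : - f y - - f x - - f' x * (y - x) <= - a / 2 * (y - x) ^+ 2.
  apply: (@taylor_upper I (fun z => - f z) (fun z => - f' z) (fun z => - f'' z)) => //.
  - by move=> z Iz; exact/has_derivative_withinN/der.
  - by move=> z Iz; exact/has_derivative_withinN/der'.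
  - by move=> z Iz; rewrite lerN2 fa.
lra.
Qed.

(** Expand at [t] towards [m] and [M] with weights [M - t] and [t - m]: the terms in [f' t] cancel,
    and the squares add up to [(M - m) * (M - t) * (t - m)], where [(M - t) * (t - m)] is the
    parabola of the statement. *)
Lemma chord_bounds f f' (a b m M : R) : m <= M ->
  {in `[m, M] &, forall x y,
    a / 2 * (y - x) ^+ 2 <= f y - f x - f' x * (y - x) <= b / 2 * (y - x) ^+ 2} ->
  exists c d, {in `[m, M], forall t,
    c + d * t - b / 2 * ((M + m) * t - M * m - t ^+ 2) <= f t <=
    c + d * t - a / 2 * ((M + m) * t - M * m - t ^+ 2)}.
Proof.
rewrite le_eqVlt => /orP[/eqP <- _|mM fab].
  exists (f m), 0 => t; rewrite in_itv /= -eq_le => /eqP <-.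
  by apply/andP; split; lra.
have MM : M \in `[m, M] by rewrite in_itv /= lexx ltW.
have mm : m \in `[m, M] by rewrite in_itv /= lexx ltW.
have Mm0 : 0 < M - m by rewrite subr_gt0.
pose d := (f M - f m) / (M - m); exists (f m - d * m), d => t tm.
have dE : f M = f m + d * (M - m) by rewrite /d divfK ?lt0r_neq0// addrC subrK.
have /andP[a1 b1] := fab t m tm mm; have /andP[a2 b2] := fab t M tm MM.
move: tm; rewrite in_itv /= => /andP[mt tM].
have t0 : 0 <= t - m by rewrite subr_ge0.
have s0 : 0 <= M - t by rewrite subr_ge0.
have {}a1 := ler_wpM2l s0 a1; have {}b1 := ler_wpM2l s0 b1.
have {}a2 := ler_wpM2l t0 a2; have {}b2 := ler_wpM2l t0 b2.
rewrite dE in a2 b2; clearbody d.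
by apply/andP; split; rewrite -(ler_pM2l Mm0); lra.
Qed.

End TaylorBounds.

(** * Bernstein approximation *)

Section BernsteinApproximation.
Context {R : realType}.
Implicit Types (g : nat -> R) (f : R -> R).

(* [bernstein n g] is \sum_k g k 'C(n, k) X^k (1 - X)^(n - k); the recursion on
   n yields its moments by induction, without binomial identities. *)
Fixpoint bernstein (n : nat) g : {poly R} :=
  if n is n'.+1 then (1%:P - 'X) * bernstein n' g + 'X * bernstein n' (g \o succn)
  else (g 0)%:P.

(** The right side is the expectation of the quadratic at a binomial variable with [n] trials of
    probability [u]. The induction conditions on one trial; a success shifts [k] by one and so
    changes the coefficients. *)
Lemma bernstein_le n g (q0 q1 q2 u : R) : 0 <= u <= 1 ->
  (forall k, (k <= n)%N -> g k <= q0 + q1 * k%:R + q2 * k%:R ^+ 2) ->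
  (bernstein n g).[u] <=
    q0 + q1 * (n%:R * u) + q2 * (n%:R * u * (1 - u) + (n%:R * u) ^+ 2).
Proof.
move=> /andP[u0 u1]; elim: n g q0 q1 q2 => [|n IH] g q0 q1 q2 gq.
  by have := gq 0 (leqnn _); rewrite /= hornerC; lra.
have u1' : 0 <= 1 - u by rewrite subr_ge0.
have h1 := IH g q0 q1 q2 (fun k kn => gq k (leqW kn)).
have gSq k : (k <= n)%N -> (g \o succn) k <=
    (q0 + q1 + q2) + (q1 + 2 * q2) * k%:R + q2 * k%:R ^+ 2.
  by move=> /(gq k.+1); rewrite -natr1 /=; lra.
have h2 := IH _ _ _ _ gSq.
have {}h1 := ler_wpM2l u1' h1; have {}h2 := ler_wpM2l u0 h2.
rewrite /= hornerD !hornerM hornerD hornerN hornerX hornerC -natr1.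
by rewrite (le_trans (lerD h1 h2))// le_eqVlt; apply/orP; left; apply/eqP; ring.
Qed.

Lemma bernsteinN n g : bernstein n (fun k => - g k) = - bernstein n g.
Proof.
elim: n g => [|n IH] g /=; first by rewrite polyCN.
by rewrite IH (IH (g \o succn)) !mulrN opprD.
Qed.

(** Transfers an inequality to a rearranged one, leaving an identity for [field]. *)
Lemma ler_of_sub_eq (x y z w : R) : y - x = w - z -> x <= y -> z <= w.
Proof. by rewrite -subr_ge0 -[z <= w]subr_ge0 => ->. Qed.

(** In the Bernstein mean of the Taylor estimate at [t] the linear term averages to zero, and the
    binomial variance bounds the rest by [K * L ^+ 2 / N * (u * (1 - u))]. *)
Lemma poly_approx f f' (K m M e : R) : m < M -> 0 <= K -> 0 < e ->
  {in `[m, M] &, forall x y,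
    `|f y - f x - f' x * (y - x)| <= K * (y - x) ^+ 2} ->
  exists p : {poly R}, {in `[m, M], forall t, `|p.[t] - f t| <= e}.
Proof.
move=> mM K0 e0 fK; pose L := M - m.
have L0 : 0 < L by rewrite subr_gt0.
have [|n /(_ _ (leqnn n))] := inv_small (K * L ^+ 2) e _ e0.
  by rewrite mulr_ge0 ?sqr_ge0.
set N : R := n.+1%:R => hN.
have N0 : 0 < N by rewrite ltr0n.
pose g k := f (m + L * k%:R / N).
exists (bernstein n.+1 g \Po (L^-1 *: ('X - m%:P))) => t tm.
have uE : (L^-1 *: ('X - m%:P)).[t] = L^-1 * (t - m) by rewrite !hornerE.
rewrite horner_comp {}uE; set u := L^-1 * _.
have tE : t = m + L * u by rewrite /u mulrA divff ?mul1r ?lt0r_neq0// addrC subrK.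
have /andP[mt tM] : m <= t <= M by move: tm; rewrite in_itv.
have u01 : 0 <= u <= 1.
  rewrite tE in mt tM; rewrite lerDl pmulr_rge0// in mt.
  move: tM; rewrite -lerBrDl -/L ger_pMr// => ->.
  by rewrite mt.
have gt k : (k <= n.+1)%N ->
    `|g k - f t - f' t * (L * (k%:R / N - u))| <= K * (L * (k%:R / N - u)) ^+ 2.
  move=> kn; have := fK t (m + L * k%:R / N) tm; rewrite -/(g k).
  rewrite (_ : m + _ - t = L * (k%:R / N - u)); last by rewrite tE; ring.
  apply; rewrite in_itv /= lerDl divr_ge0 ?mulr_ge0 ?(ltW L0) ?(ltW N0)//=.
  by rewrite -lerBrDl ler_pdivrMr// ler_wpM2l ?(ltW L0)// ler_nat.
have err : K * L ^+ 2 / N * (u * (1 - u)) <= e.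
  rewrite (le_trans _ hN)// mulrC [leRHS]mulrC ler_piMl//.
    by apply: divr_ge0; [rewrite mulr_ge0 ?sqr_ge0|exact: ltW].
  by case/andP: u01 => ? ?; nra.
have N1 : N != 0 by rewrite lt0r_neq0.
have up : (bernstein n.+1 g).[u] <= f t + e.
  (* The coefficients in [k] of [f t + f' t * (L * (k / N - u)) + K * (L * (k / N - u)) ^+ 2]. *)
  have h := @bernstein_le n.+1 g
    (f t - f' t * L * u + K * L ^+ 2 * u ^+ 2)
    (f' t * L / N - 2 * K * L ^+ 2 / N * u) (K * L ^+ 2 / N ^+ 2) u u01.
  rewrite (le_trans (h _))// -/N => [k /gt|].
    by rewrite ler_norml => /andP[_]; apply: ler_of_sub_eq; field.
  by move: err; apply: ler_of_sub_eq; field.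
have dn : (bernstein n.+1 (fun k => - g k)).[u] <= - f t + e.
  have h := @bernstein_le n.+1 (fun k => - g k)
    (- f t + f' t * L * u + K * L ^+ 2 * u ^+ 2)
    (- f' t * L / N - 2 * K * L ^+ 2 / N * u) (K * L ^+ 2 / N ^+ 2) u u01.
  rewrite (le_trans (h _))// -/N => [k /gt|].
    by rewrite ler_norml => /andP[+ _]; apply: ler_of_sub_eq; field.
  by move: err; apply: ler_of_sub_eq; field.
move: up dn; rewrite bernsteinN hornerN ler_norml.
by move: (bernstein _ _).[u] => w; lra.
Qed.

End BernsteinApproximation.

(** * Chord parabolas evaluated at operators *)

Section ChordOperators.
Context {R : realType}.

Definition chord_poly (m M c d k : R) : {poly R} :=
  c%:P + d *: 'X - (k / 2) *: ((M + m) *: 'X - (M * m)%:P - 'X * 'X).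

Lemma horner_chord_poly (m M c d k t : R) : (chord_poly m M c d k).[t] =
  c + d * t - k / 2 * ((M + m) * t - M * m - t ^+ 2).
Proof. by rewrite !hornerE; ring. Qed.

Lemma poly_op_chord (H : hilbertType R) (m M c d k : R) (A : bop H) :
  poly_op (chord_poly m M c d k) A = scalar_op c%:C + d%:C *: A -
    (k / 2)%:C *: ((M + m)%:C *: A - scalar_op (M * m)%:C - A ^+ 2).
Proof.
by rewrite !(poly_opB, poly_opD, poly_opZ) !poly_opC poly_opM poly_opX expr2.
Qed.

(** For [t < m] the operator [T - t] is coercive, and for [t > M] so is [t - T]. *)
Lemma spectrum_itv (H : hilbertType R) (T : bop H) (m M : R) : selfadjoint T ->
  positive_op (T - scalar_op m%:C) -> positive_op (scalar_op M%:C - T) ->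
  forall t : R, spectrum T t%:C -> t \in `[m, M].
Proof.
move=> sT /positive_opP[_ mT] /positive_opP[_ TM] t Tt.
have sTt : selfadjoint (T - scalar_op t%:C).
  rewrite -(poly_opC t T) -{1}[T]poly_opX -poly_opB.
  exact: poly_op_selfadjoint.
rewrite in_itv /= !leNgt; apply/andP; split; apply/negP => tlt; apply: Tt.
  apply: (@coercive_invertible _ _ _ (m - t)); rewrite ?subr_gt0// => x.
  by have := mT x; rewrite !bopE !rdotBl !rdotZl; lra.
have -> : T - scalar_op t%:C = (-1 : R[i]) *: (scalar_op t%:C - T).
  by rewrite scaleN1r opprB.
apply: invertibleZ; first by rewrite oppr_eq0 oner_eq0.
apply: (@coercive_invertible _ _ _ (t - M)); rewrite ?subr_gt0//.
  rewrite -(poly_opC t T) -{2}[T]poly_opX -poly_opB.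
  exact: poly_op_selfadjoint.
by move=> x; have := TM x; rewrite !bopE !rdotBl !rdotZl; lra.
Qed.

Lemma cfc_chord (H : hilbertType R) (A : bop H) (f : R -> R)
    (m M c d a b : R) : selfadjoint A ->
  (forall t : R, spectrum A t%:C -> t \in `[m, M]) ->
  (forall e : R, 0 < e -> exists p : {poly R},
    {in `[m, M], forall t, `|p.[t] - f t| <= e}) ->
  {in `[m, M], forall t,
    c + d * t - b / 2 * ((M + m) * t - M * m - t ^+ 2) <= f t <=
    c + d * t - a / 2 * ((M + m) * t - M * m - t ^+ 2)} ->
  poly_op (chord_poly m M c d b) A <=L cfc f A /\
  cfc f A <=L poly_op (chord_poly m M c d a) A.
Proof.
move=> sA spA fp fch.
have fA : is_cfc f A (cfc f A).
  (* Existence rules out the default value [0] of [xget]. *)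
  apply: xgetPex; apply: cfc_exists => // e e0.
  by have [p hp] := fp e e0; exists p => t /spA/hp.
split.
  apply: (is_cfc_ge _ _ _ _ sA fA) => t /spA/fch /andP[].
  by rewrite horner_chord_poly.
apply: (is_cfc_le _ _ _ _ sA fA) => t /spA/fch /andP[].
by rewrite horner_chord_poly.
Qed.

End ChordOperators.

Theorem theorem2p1 (R : realType) (H K : hilbertType R)
    (I : set R) (I_itv : is_interval I)
    (f f' f'' : R -> R) (alpha beta : R)
    (f_cont : {within I, continuous f})
    (f_der : forall x, I x -> has_derivative_within I f x (f' x))
    (f'_der : forall x, I x -> has_derivative_within I f' x (f'' x))
    (f''_bnd : forall x, I x -> alpha <= f'' x <= beta)
    (Phi : {linear bop H -> bop K})
    (Phi_pos : positive_map Phi) (Phi_unital : unital_map Phi)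
    (A : bop H) (A_sa : selfadjoint A) (m M : R)
    (A_sp : spectrum A `<=` [set t%:C | t in `[m, M]])
    (mM_I : `[m, M] `<=` I) :
  cfc f (Phi A) <=L
    Phi (cfc f A)
    + ((beta - alpha) / 2)%:C *: ((M + m)%:C *: Phi A - scalar_op (M * m)%:C)
    + (1 / 2)%:C *: (alpha%:C *: Phi A ^+ 2 - beta%:C *: Phi (A ^+ 2))
  /\
  Phi (cfc f A) <=L
    cfc f (Phi A)
    + ((beta - alpha) / 2)%:C *: ((M + m)%:C *: Phi A - scalar_op (M * m)%:C)
    + (1 / 2)%:C *: (alpha%:C *: Phi (A ^+ 2) - beta%:C *: Phi A ^+ 2).
Proof.
have spA (t : R) : spectrum A t%:C -> t \in `[m, M].
  by move=> /A_sp[u /= um []] <-.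
have [mM|Mm] := leP m M; last first.
  (* If [M < m], the spectrum has no real point, so [H] is zero; then [1 = Phi 1 = Phi 0 = 0] makes
     [K] zero too. *)
  have H0 : forall x : H, x = 0.
    apply: (spectrum_empty A) => // t /spA; rewrite in_itv /= => /andP[mt tM].
    by move: (le_trans mt tM); rewrite leNgt Mm.
  have K0 (y : K) : y = 0.
    rewrite -[LHS]bop1E -Phi_unital (_ : 1 = 0); first by rewrite linear0.
    by apply: bopP => x; rewrite [LHS]H0 [RHS]H0.
  by split=> y; rewrite [y]K0 linear0r.
have mAM : positive_op (Phi A - scalar_op m%:C) /\
    positive_op (scalar_op M%:C - Phi A).
  have PhiC (t : R) : scalar_op t%:C = Phi (scalar_op t%:C).
    by rewrite linearZ /= Phi_unital.
  rewrite !PhiC -!linearB; split; apply: Phi_pos.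
    rewrite -(poly_opC m A) -{1}[A]poly_opX -poly_opB.
    apply: poly_op_positive => // t /spA; rewrite in_itv /= !hornerE subr_ge0.
    by case/andP.
  rewrite -(poly_opC M A) -{2}[A]poly_opX -poly_opB.
  apply: poly_op_positive => // t /spA; rewrite in_itv /= !hornerE subr_ge0.
  by case/andP.
have sPA : selfadjoint (Phi A).
  (* [Phi A - m] is positive, hence self-adjoint, and adding a real scalar preserves this. *)
  have [/positive_opP[/selfadjointP s _] _] := mAM.
  apply/selfadjointP => x y; have := s x y.
  by rewrite !bopE rdotBl rdotBr rdotZl rdotZr; lra.
have spPA := spectrum_itv _ _ _ _ sPA mAM.1 mAM.2.
have taylor : {in `[m, M] &, forall x y, alpha / 2 * (y - x) ^+ 2 <=
    f y - f x - f' x * (y - x) <= beta / 2 * (y - x) ^+ 2}.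
  move=> x y /mM_I Ix /mM_I Iy; apply/andP; split.
    apply: (taylor_lower I f f' f'') => // z Iz.
    by case/andP: (f''_bnd z Iz).
  apply: (taylor_upper I f f' f'') => // z Iz.
  by case/andP: (f''_bnd z Iz).
have [c [d chord]] := chord_bounds f f' alpha beta m M mM taylor.
have approx (e : R) : 0 < e -> exists p : {poly R},
    {in `[m, M], forall t, `|p.[t] - f t| <= e}.
  move=> e0; move: mM; rewrite le_eqVlt => /orP[/eqP <-|mM'].
    exists (f m)%:P => t; rewrite in_itv /= -eq_le => /eqP <-.
    by rewrite hornerC subrr normr0 ltW.
  (* This constant dominates both [- alpha / 2] and [beta / 2]. *)
  apply: (poly_approx f f' (`|alpha| + `|beta|) m M e) => //.
  move=> x y xm ym; have := taylor x y xm ym; rewrite ler_norml => /andP[h1 h2].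
  have s0 := sqr_ge0 (y - x).
  have := ler_norm alpha; have := ler_norm beta; have := ler_norm (- alpha).
  have := normr_ge0 alpha; have := normr_ge0 beta; rewrite normrN => *.
  by apply/andP; split; nra.
have [lA uA] := cfc_chord _ A f m M c d alpha beta A_sa spA approx chord.
have [lP uP] := cfc_chord _ (Phi A) f m M c d alpha beta sPA spPA approx chord.
move/Phi_pos: lA; move/Phi_pos: uA; move: lP uP.
rewrite /loewner_le !poly_op_chord /scalar_op.
rewrite !(linearB, linearD, linearZ) /= Phi_unital => lP uP uA lA.
split=> y.
  (* Upper bound at [Phi A] plus lower bound at [A]: the chord [c + d * Phi A] cancels. *)
  have := addr_ge0 (uP y) (lA y); congr (0 <= _).
  rewrite !bopE !(linearBl, linearDl, linearZl_LR, linearNl) /=.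
  rewrite !(rmorphM, rmorphB, rmorphD, fmorphV, rmorph1, rmorph_nat) /=.
  by field.
(* The same with the two operators exchanged. *)
have := addr_ge0 (lP y) (uA y); congr (0 <= _).
rewrite !bopE !(linearBl, linearDl, linearZl_LR, linearNl) /=.
rewrite !(rmorphM, rmorphB, rmorphD, fmorphV, rmorph1, rmorph_nat) /=.
by field.
Qed.
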